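(* Let $L=(V,E)$ be a finite simple connected $\bar d$-regular graph on $\bar n$ vertices whose complement graph $L^c$ is also connected, and let $k\in\{1,\dots,\bar n-1\}$. Let $\mathfrak{S}_k^{MC}$ be the Markov chain on the $k$-token graph $\mathfrak{L}_k=(\mathfrak{V}_k,\mathfrak{E}_k)$ of $L$ described in the context. Then $\mathfrak{S}_k^{MC}$ is aperiodic, irreducible and, hence, ergodic. Furthermore, it is a reversible chain, and its stationary distribution $\pi_k^{MC}$ is given for $\mathfrak{v}\in\mathfrak{V}_k$ by $$\pi_k^{MC}(\mathfrak{v})=\frac{\mathrm{deg}_k(\mathfrak{v})+k}{2|\mathfrak{E}_k|+k\binom{\bar n}{k}}.$$
   Context: Token graph: for a finite simple graph $L=(V,E)$ and $k\in\{1,\dots,|V|-1\}$, let $\mathfrak{V}_k=\{\mathfrak{v}\subset V : |\mathfrak{v}|=k\}$, and let $\mathfrak{E}_k$ be the set of unordered pairs $\langle\mathfrak{v},\mathfrak{w}\rangle$ of elements of $\mathfrak{V}_k$ such that the symmetric difference is $\mathfrak{v}\triangle\mathfrak{w}=\{v,w\}$ for some edge $\langle v,w\rangle\in E$. The graph $\mathfrak{L}_k=(\mathfrak{V}_k,\mathfrak{E}_k)$ is the $k$-token graph of $L$, and $\mathrm{deg}_k(\mathfrak{v})$ denotes the degree of $\mathfrak{v}$ in $\mathfrak{L}_k$ (equivalently, the number of edges of $L$ between $\mathfrak{v}$ and $V\setminus\mathfrak{v}$). The chain: $\mathfrak{S}_k^{MC}$ is the discrete-time Markov chain on $\mathfrak{V}_k$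 recording the set of occupied vertices of the following exclusion process of $k$ particles on $L$. If the set of occupied vertices is $\mathfrak{v}\in\mathfrak{V}_k$, let $\Sigma'(\mathfrak{v})$ consist of all edges of $L$ with one endpoint in $\mathfrak{v}$ and the other in $V\setminus\mathfrak{v}$, together with one loop at each vertex of $\mathfrak{v}$. One element of $\Sigma'(\mathfrak{v})$ is drawn uniformly at random (independently of the past given $\mathfrak{v}$). If an edge $\langle x,y\rangle$ with $x\in\mathfrak{v}$, $y\notin\mathfrak{v}$ is drawn, the occupation states of $x$ and $y$ are exchanged, so the new state is $(\mathfrak{v}\setminus\{x\})\cup\{y\}$; if a loop is drawn, the state remains $\mathfrak{v}$. *)

(* Defs.v *)
From HB Require Import structures.
From mathcomp Require Import all_boot all_order all_algebra.
From mathcomp Require Import all_classical all_reals.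
From mathcomp Require Import topology normedtype sequences.

Set Implicit Arguments.
Unset Strict Implicit.
Unset Printing Implicit Defensive.

Import Order.TTheory GRing.Theory Num.Theory.
Import numFieldNormedType.Exports.

Local Open Scope classical_set_scope.
Local Open Scope ring_scope.

Record sgraph := SGraph {
  vertex :> finType;
  adj : rel vertex;
  adj_sym : symmetric adj;
  adj_irrefl : irreflexive adj
}.

Definition edges (G : sgraph) : {set {set G}} :=
  [set e | [exists x, exists y, adj x y && (e == [set x; y]%SET)]].

Definition deg (G : sgraph) (x : G) : nat := #|[set y | adj x y]%SET|.

Definition regular_graph (G : sgraph) (d : nat) : Prop :=
  forall x : G, deg x = d.

Definition connected_graph (G : sgraph) : Prop :=
  forall x y : G, connect (@adj G) x y.

Section Complement.
Variable G : sgraph.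

Definition compl_adj : rel G := fun x y => (x != y) && ~~ adj x y.

Fact compl_adj_sym : symmetric compl_adj.
Proof. by move=> x y; rewrite /compl_adj eq_sym adj_sym. Qed.

Fact compl_adj_irrefl : irreflexive compl_adj.
Proof. by move=> x; rewrite /compl_adj eqxx. Qed.

Definition compl_graph := SGraph compl_adj_sym compl_adj_irrefl.
End Complement.

Definition symdiff (T : finType) (A B : {set T}) : {set T} :=
  ((A :\: B) :|: (B :\: A))%SET.

Section TokenGraph.
Variables (L : sgraph) (k : nat).

Definition token : finType := {v : {set L} | #|v| == k}.

Definition token_set (v : token) : {set L} := sval v.

Definition token_adj : rel token := fun v w =>
  [exists x, exists y,
    adj x y && (symdiff (token_set v) (token_set w) == [set x; y]%SET)].

Fact token_adj_sym : symmetric token_adj.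
Proof. by move=> v w; rewrite /token_adj /symdiff finset.setUC. Qed.

Fact token_adj_irrefl : irreflexive token_adj.
Proof.
move=> v; apply/negbTE/existsP => -[x /existsP[y /andP[_ /eqP/setP/(_ x)]]].
by rewrite !inE eqxx; case: (x \in token_set v).
Qed.

Definition token_graph := SGraph token_adj_sym token_adj_irrefl.
End TokenGraph.

Record markov_chain (R : realType) (S : finType) := MarkovChain {
  trans :> S -> S -> R;
  trans_ge0 : forall x y, 0 <= trans x y;
  trans_sum1 : forall x, \sum_y trans x y = 1
}.

Section MarkovChains.
Variables (R : realType) (S : finType) (P : markov_chain R S).

Fixpoint nstep (t : nat) (x y : S) : R :=
  if t is t'.+1 then \sum_z P x z * nstep t' z y else (x == y)%:R.

Definition irreducible : Prop := forall x y, exists t, 0 < nstep t x y.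

(* The period of x is the gcd of its positive return times, given here by the
   universal property of the gcd. *)
Definition return_divisor (x : S) (d : nat) : Prop :=
  forall t, (0 < t)%N -> 0 < nstep t x x -> (d %| t)%N.

Definition is_period (x : S) (g : nat) : Prop :=
  return_divisor x g /\ forall d, return_divisor x d -> (d %| g)%N.

Definition aperiodic : Prop := forall x, is_period x 1.

Definition is_distribution (pi : S -> R) : Prop :=
  (forall x, 0 <= pi x) /\ \sum_x pi x = 1.

Definition stationary (pi : S -> R) : Prop :=
  is_distribution pi /\ forall y, \sum_x pi x * P x y = pi y.

Definition ergodic : Prop :=
  exists pi : S -> R,
    [/\ stationary pi, forall x, 0 < pi x &
      forall mu : S -> R, is_distribution mu ->
        forall y, (\sum_x mu x * nstep t x y) @[t --> \oo] --> pi y].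

Definition reversible : Prop :=
  exists pi : S -> R,
    stationary pi /\ forall x y, pi x * P x y = pi y * P y x.

End MarkovChains.

Section ExclusionChain.
Variables (R : realType) (L : sgraph) (k : nat).

(* [inl e] is the edge e of L, [inr x] is the loop at x. *)
Definition draws (v : {set L}) : {set ({set L} + L)} :=
  [set s | match s with
           | inl e => (e \in edges L) &&
               [exists x in v, exists y in ~: v, e == [set x; y]%SET]
           | inr x => x \in v
           end].

(* Exchanging the occupation states of the ends x \in v and y \notin v of e
   turns v into (v \ {x}) U {y}, which is the symmetric difference of v and
   e = {x, y}. *)
Definition next_state (v : {set L}) (s : {set L} + L) : {set L} :=
  match s with inl e => symdiff v e | inr _ => v end.

Lemma card_next_state v s : s \in draws v -> #|next_state v s| = #|v|.
Proof.
rewrite inE; case: s => [e /andP[_ /exists_inP[x xv /exists_inP[y]]] | //] /=.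
rewrite inE => yv /eqP->.
have -> : symdiff v [set x; y]%SET = (y |: (v :\ x))%SET.
  apply/setP => z; rewrite !inE.
  have [->|_] := eqVneq z x.
    by rewrite xv /=; case: eqP yv => // <-; rewrite xv.
  have [->|_] := eqVneq z y; first by rewrite (negbTE yv).
  by rewrite orFb andbF orbF.
rewrite cardsU1 !inE (negbTE yv) andbF add1n.
by rewrite [RHS](cardsD1 x) xv.
Qed.

Definition exclusion_trans (v w : token L k) : R :=
  #|[set s in draws (token_set v)
      | next_state (token_set v) s == token_set w]|%:R
  / #|draws (token_set v)|%:R.

Lemma exclusion_trans_ge0 v w : 0 <= exclusion_trans v w.
Proof. by rewrite divr_ge0. Qed.

Lemma exclusion_trans_sum1 (k_gt0 : (0 < k)%N) v :
  \sum_w exclusion_trans v w = 1.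
Proof.
have /card_gt0P[x xv] : (0 < #|token_set v|)%N by rewrite (eqP (valP v)).
have D_gt0 : (0 < #|draws (token_set v)|)%N.
  by apply/card_gt0P; exists (inr x); rewrite inE.
have sum_draws : (\sum_(w : token L k) #|[set s in draws (token_set v)
    | next_state (token_set v) s == token_set w]|)%N = #|draws (token_set v)|.
  rewrite -[RHS]sum1_card (partition_big
    (fun s => insubd v (next_state (token_set v) s) : token L k) xpredT) //=.
  apply: eq_bigr => w _; rewrite -sum1_card; apply: eq_bigl => s.
  rewrite inE; case sD: (s \in draws _) => //=.
  have sk : #|next_state (token_set v) s| == k.
    by rewrite (card_next_state sD) (valP v).
  by rewrite -[in RHS](inj_eq val_inj) insubdK.
by rewrite -mulr_suml -natr_sum sum_draws divff // pnatr_eq0 -lt0n.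
Qed.

Definition exclusion_chain (k_gt0 : (0 < k)%N) : markov_chain R (token L k) :=
  MarkovChain exclusion_trans_ge0 (exclusion_trans_sum1 k_gt0).

End ExclusionChain.

(* Main.v *)
Require Import Defs.
From mathcomp Require Import all_boot all_order all_algebra all_reals.
From mathcomp Require Import classical_sets topology normedtype sequences.

Import Order.TTheory GRing.Theory Num.Theory.
Import numFieldNormedType.Exports.

Local Open Scope ring_scope.

(** From a state v there are deg_k(v) + k draws: each neighbour w of v in the
token graph is reached by exactly one of them, the edge of L which is the
symmetric difference of v and w, and the k loops stay at v
([card_draws_to]). Hence the transition probability from v to w is
(A(v, w) + k [v = w]) / (deg_k(v) + k), with A the symmetric adjacency matrix
of the token graph ([exclusion_transE]), so the weights deg_k(v) + k are in
detailed balance ([exclusion_detailed_balance]). By the handshake lemma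
([sum_deg]) they add up to 2 |E_k| + k C(n, k), which gives the stationary
distribution.

The loops make the chain aperiodic. It is irreducible since the token graph
of a connected graph is connected ([connected_token_graph]): along a path of
L from an occupied vertex x to an empty vertex y, a succession of exclusion
moves has the net effect of moving the token from x to y
([connect_token_move]), and such moves turn any k-set into any other.

Convergence to the stationary distribution is Doeblin's argument. An
irreducible chain that can stay put at every state has a time T at which all
the transition probabilities are at least some a > 0
([nstep_uniform_lower_bound]). Applied to a signed measure of total mass 0,
such a kernel contracts the l1 norm by the factor 1 - |S| a
([l1_contraction]), so that the distance between the law of the chain and a
stationary distribution tends to 0 ([nstep_cvg_stationary]). This also shows
that the stationary distribution is unique ([stationary_unique]). *)

(** * Handshake lemma *)

(** Each edge is counted twice, as two ordered pairs of adjacent vertices. *)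
Lemma sum_deg (G : sgraph) : (\sum_(x : G) deg x = 2 * #|edges G|)%N.
Proof.
rewrite /deg; under eq_bigr do rewrite -sum1dep_card.
rewrite pair_big_dep /=.
rewrite (partition_big (fun p : G * G => [set p.1; p.2]%SET)
  (fun e => e \in edges G)) /=; last first.
  move=> [x y] /= xy; rewrite inE; apply/existsP; exists x; apply/existsP.
  by exists y; rewrite xy eqxx.
rewrite mulnC -sum_nat_const; apply: eq_bigr => e.
rewrite inE => /existsP[a /existsP[b /andP[ab /eqP->]]].
have nab : a != b by apply: contraTneq ab => ->; rewrite adj_irrefl.
rewrite sum1dep_card -[RHS](_ : #|[set (a, b); (b, a)]%SET| = 2); last first.
  by rewrite cards2 xpair_eqE negb_and nab.
congr #|pred_of_set _|; apply/setP => -[x y]; rewrite !inE !xpair_eqE /=.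
apply/andP/orP => [[xy /eqP/setP eq_xy]|].
  have nxy : x != y by apply: contraTneq xy => ->; rewrite adj_irrefl.
  have := eq_xy x; have := eq_xy y; rewrite !inE !eqxx /= orbT.
  move=> /esym/orP[]/eqP ey /esym/orP[]/eqP ex;
    rewrite ex ey ?eqxx in nxy *; by [left|right|].
by case=> /andP[/eqP-> /eqP->]; rewrite ?eqxx ?ab // adj_sym ab finset.setUC.
Qed.

(** * The token graph and the draws of the exclusion process *)

Lemma symdiffK (T : finType) (A : {set T}) : involutive (symdiff A).
Proof.
by move=> B; apply/setP => z; rewrite !inE; case: (z \in A); case: (z \in B).
Qed.

Section Token.
Variables (L : sgraph) (k : nat).
Implicit Types v w : token L k.

Lemma card_token : #|token L k| = 'C(#|L|, k).
Proof.
by rewrite card_sig -card_draws -sum1dep_card -sum1_card; apply: eq_bigl.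
Qed.

Lemma card_token_set v : #|token_set v| = k.
Proof. exact/eqP/(valP v). Qed.

Lemma token_set_inj : injective (@token_set L k).
Proof. exact: val_inj. Qed.

Lemma token_set_sub_eq v w : token_set v \subset token_set w -> v = w.
Proof.
move=> vw; apply: val_inj; apply/eqP.
by rewrite eqEcard [_ \subset _]vw /= !card_token_set leqnn.
Qed.

(** The only edge of L whose drawing leads from v to w is their symmetric
difference, and it can be drawn exactly when v and w are adjacent. *)
Lemma draw_edgeE v w (e : {set L}) :
  (inl e \in draws (token_set v)) && (symdiff (token_set v) e == token_set w)
  = token_adj v w && (e == symdiff (token_set v) (token_set w)).
Proof.
apply/andP/andP => [[ev /eqP vew]|
                    [/existsP[x /existsP[y /andP[xy /eqP vw]]] /eqP ->]].
  rewrite -vew symdiffK eqxx; split=> //.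
  move: ev; rewrite inE /= => /andP[+ _]; rewrite inE.
  case/existsP=> x /existsP[y /andP[xy /eqP exy]].
  apply/existsP; exists x; apply/existsP; exists y.
  by rewrite xy -vew symdiffK exy eqxx.
rewrite symdiffK eqxx; split=> //; rewrite inE; apply/andP; split.
  rewrite inE; apply/existsP; exists x; apply/existsP.
  by exists y; rewrite xy vw eqxx.
have D z : (z \in token_set v) (+) (z \in token_set w) = (z == x) || (z == y).
  move/setP: vw => /(_ z); rewrite !inE => <-.
  by case: (z \in token_set v); case: (z \in token_set w).
have vNw : v != w.
  by apply: contraTneq isT => vw'; have := D x; rewrite vw' addbb eqxx.
have := D x; have := D y; rewrite !eqxx orbT /=.
(* Exactly one of x and y lies in v: otherwise v and w, of the same size k,
   would be nested, hence equal. *)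
have [xv|xv] := boolP (x \in token_set v);
    have [yv|yv] := boolP (y \in token_set v) => /= yw xw.
- case/eqP: vNw; apply/esym/token_set_sub_eq/fintype.subsetP => z zw.
  have := D z; rewrite zw; have [->|_] := eqVneq z x; first by rewrite xv.
  by have [->|_] := eqVneq z y; [rewrite yv|case: (z \in _)].
- apply/exists_inP; exists x => //; apply/exists_inP; exists y; rewrite ?inE //.
  exact/eqP.
- apply/exists_inP; exists y => //; apply/exists_inP; exists x; rewrite ?inE //.
  by rewrite vw finset.setUC.
- case/eqP: vNw; apply/token_set_sub_eq/fintype.subsetP => z zv.
  have := D z; rewrite zv; have [zx|_] := eqVneq z x.
    by rewrite -zx zv in xv.
  by have [zy|_] := eqVneq z y; [rewrite -zy zv in yv|case: (z \in _)].
Qed.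

Lemma card_draws_to v w :
  #|[set s in draws (token_set v)
      | next_state (token_set v) s == token_set w]%SET|
  = (token_adj v w + k * (v == w))%N.
Proof.
have [->|vw] := eqVneq v w.
  rewrite token_adj_irrefl muln1 add0n -[RHS](card_token_set w).
  rewrite -(card_imset (mem (token_set w)) (@inr_inj {set L} L)).
  congr #|pred_of_set _|; apply/setP => -[e|x]; rewrite inE /=.
    rewrite draw_edgeE token_adj_irrefl; symmetry.
    by apply/imsetP => -[].
  by rewrite eqxx andbT inE (mem_imset _ _ inr_inj).
have drawsP e : (inr e \in draws (token_set v)) &&
    (token_set v == token_set w) = false.
  by rewrite (inj_eq val_inj) (negbTE vw) andbF.
rewrite muln0 addn0; have [vaw|vaw] := boolP (token_adj v w).
  rewrite /= -(cards1 (inl (symdiff (token_set v) (token_set w)) : {set L} + L)).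
  congr #|pred_of_set _|; apply/setP => -[e|x];
    rewrite !finset.in_set1 inE ?drawsP //=.
  by rewrite draw_edgeE vaw.
apply/eqP; rewrite cards_eq0; apply/eqP/setP => -[e|x];
  rewrite inE finset.in_set0 //=.
by rewrite draw_edgeE (negbTE vaw).
Qed.

(** The state obtained from v by moving the token at x to y. It is meaningful
when x is occupied and y is empty in v; otherwise the set need not have k
elements, and v is then the default value. *)
Definition token_move v (x y : L) : token L k :=
  insubd v (y |: token_set v :\ x)%SET.

Lemma token_set_move v (x y : L) : x \in token_set v -> y \notin token_set v ->
  token_set (token_move v x y) = (y |: token_set v :\ x)%SET.
Proof.
move=> xv yv; rewrite /token_set /token_move val_insubd ifT //.
rewrite cardsU1 !inE [y \in sval v](negbTE yv) andbF add1n.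
by have := card_token_set v; rewrite (cardsD1 x) xv => /eqP.
Qed.

Lemma token_adj_move v (x y : L) : x \in token_set v -> y \notin token_set v ->
  adj x y -> token_adj v (token_move v x y).
Proof.
move=> xv yv xy; apply/existsP; exists x; apply/existsP; exists y.
rewrite xy token_set_move //=; apply/eqP/setP => z; rewrite !inE.
have [->|_] := eqVneq z x.
  by rewrite xv !orbF /= andbT; apply/(contraNneq _ yv) => <-.
have [->|_] := eqVneq z y; first by rewrite (negbTE yv).
by case: (z \in token_set v).
Qed.

(** The intermediate vertices of the path from x to y may be occupied. With z
the vertex after x: if z is occupied, the token at z is first sent to y, and x
then moves to the freed z; if z is empty, x moves to z and then on to y. *)
Lemma connect_token_move v (x y : L) :
  x \in token_set v -> y \notin token_set v ->
  connect (@adj L) x y -> connect (@token_adj L k) v (token_move v x y).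
Proof.
move=> + + /connectP[p]; elim: p x v => [|z p IHp] x v /= xv yv.
  by move=> _ yx; rewrite yx xv in yv.
move=> /andP[xz zp] yE.
have xy : x != y by apply: contraNneq yv => <-.
have zx : z != x by apply: contraTneq xz => ->; rewrite adj_irrefl.
have [zv|zv] := boolP (z \in token_set v).
  have vmE := token_set_move v z y zv yv.
  apply: (connect_trans (IHp z v zv yv zp yE)).
  apply: connect1.
  have zy : z != y by apply: contraNneq yv => <-.
  have xm : x \in token_set (token_move v z y).
    by rewrite vmE !inE [x == z]eq_sym zx xv orbT.
  have zm : z \notin token_set (token_move v z y).
    by rewrite vmE !inE eqxx (negbTE zy).
  have -> : token_move v x y = token_move (token_move v z y) x z.
    apply: token_set_inj.
    rewrite (token_set_move _ _ _ xv yv) (token_set_move _ _ _ xm zm) vmE.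
    apply/setP => u; rewrite !inE.
    have [->|_] := eqVneq u z; first by rewrite zv zx orbT.
    by have [->|//] := eqVneq u y; rewrite eq_sym xy.
  exact: token_adj_move.
have [<-|zy] := eqVneq z y; first exact/connect1/token_adj_move.
apply: (connect_trans (connect1 (token_adj_move _ _ _ xv zv xz))).
have vmE := token_set_move v x z xv zv.
have zm : z \in token_set (token_move v x z) by rewrite vmE !inE eqxx.
have ym : y \notin token_set (token_move v x z).
  by rewrite vmE !inE negb_or eq_sym zy (negbTE yv) andbF.
have -> : token_move v x y = token_move (token_move v x z) z y.
  apply: token_set_inj.
  rewrite (token_set_move _ _ _ xv yv) (token_set_move _ _ _ zm ym) vmE.
  apply/setP => u; rewrite !inE.
  have [->|//] := eqVneq u z; by rewrite (negbTE zv) andbF.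
exact: IHp.
Qed.

(** By induction on the number of tokens of v that lie outside w. *)
Lemma connected_token_graph :
  connected_graph L -> connected_graph (token_graph L k).
Proof.
move=> connL v w; rewrite /=.
have [m] := ubnP #|token_set v :\: token_set w|; elim: m v => // m IHm v lt_m.
have [vw|/fintype.subsetPn[x xv xw]] := boolP (token_set v \subset token_set w).
  by rewrite (token_set_sub_eq _ _ vw) connect0.
have /fintype.subsetPn[y yw yv] : ~~ (token_set w \subset token_set v).
  by apply: contra xw => /token_set_sub_eq ->.
apply: (connect_trans (connect_token_move v x y xv yv (connL x y))).
apply: IHm; rewrite -ltnS; apply: leq_trans lt_m; rewrite ltnS.
apply/proper_card/properP; rewrite token_set_move //; split.
  apply/fintype.subsetP => u; rewrite !inE.
  move=> /andP[uw /orP[/eqP uy|/andP[_ ->]]].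
    by rewrite uy yw in uw.
  by rewrite uw.
by exists x; rewrite !inE ?xv ?xw //= eqxx orbF; apply: contraNneq yv => <-.
Qed.

End Token.

(** * Convergence of finite Markov chains *)

Section FiniteChain.
Variables (R : realType) (S : finType) (P : markov_chain R S).

Lemma nstep1 x y : nstep P 1 x y = P x y.
Proof.
rewrite /= (bigD1 y) //= eqxx mulr1 big1 ?addr0 // => z /negbTE->.
by rewrite mulr0.
Qed.

Lemma nstep_ge0 t x y : 0 <= nstep P t x y.
Proof.
elim: t x => [|t IHt] x /=; first by case: eqP.
by apply: sumr_ge0 => z _; rewrite mulr_ge0 ?trans_ge0.
Qed.

Lemma nstep_sum1 t x : \sum_y nstep P t x y = 1.
Proof.
elim: t x => [|t IHt] x /=.
  rewrite (bigD1 x) //= eqxx big1 ?addr0 // => y.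
  by rewrite eq_sym => /negbTE->.
rewrite exchange_big /= -[RHS](trans_sum1 P x); apply: eq_bigr => z _.
by rewrite -mulr_sumr IHt mulr1.
Qed.

Lemma nstepD s t x y :
  nstep P (s + t) x y = \sum_z nstep P s x z * nstep P t z y.
Proof.
elim: s x => [|s IHs] x /=.
  rewrite (bigD1 x) //= eqxx mul1r big1 ?addr0 // => z.
  by rewrite eq_sym => /negbTE->; rewrite mul0r.
under eq_bigr do rewrite IHs mulr_sumr.
rewrite exchange_big; apply: eq_bigr => z _; rewrite mulr_suml.
by apply: eq_bigr => u _; rewrite mulrA.
Qed.

Lemma nstepS_gt0 t x y z :
  0 < P x z -> 0 < nstep P t z y -> 0 < nstep P t.+1 x y.
Proof.
move=> xz zy; rewrite /= (bigD1 z) //=; apply: ltr_pwDl; first exact: mulr_gt0.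
by apply: sumr_ge0 => u _; rewrite mulr_ge0 ?trans_ge0 ?nstep_ge0.
Qed.

Lemma connected_irreducible (e : rel S) :
  (forall x y, e x y -> 0 < P x y) -> (forall x y, connect e x y) ->
  irreducible P.
Proof.
move=> eP connS x y; have /connectP[p] := connS x y.
elim: p x => [|z p IHp] x /= => [_ ->|/andP[xz zp] yE].
  by exists 0%N; rewrite /= eqxx ltr01.
by have [t zy] := IHp z zp yE; exists t.+1; apply: nstepS_gt0 zy; apply: eP.
Qed.

Lemma stationary_nstep pi t y :
  stationary P pi -> \sum_x pi x * nstep P t x y = pi y.
Proof.
move=> [_ piP]; elim: t => [|t IHt].
  rewrite /= (bigD1 y) //= eqxx mulr1 big1 ?addr0 // => x /negbTE->.
  by rewrite mulr0.
rewrite -[RHS]IHt; under eq_bigr do rewrite /= mulr_sumr.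
rewrite exchange_big; apply: eq_bigr => z _ /=; rewrite -(piP z) mulr_suml.
by apply: eq_bigr => x _; rewrite mulrA.
Qed.

Lemma detailed_balance_stationary pi :
  is_distribution pi -> (forall x y, pi x * P x y = pi y * P y x) ->
  stationary P pi.
Proof.
move=> pi_dist piP; split=> // y; under eq_bigr do rewrite piP.
by rewrite -mulr_sumr trans_sum1 mulr1.
Qed.

(** Doeblin's contraction: since nu has total mass 0, replacing K by K - a,
which is nonnegative with row sums 1 - |S| a, does not change the image of
nu. *)
Lemma l1_contraction (K : S -> S -> R) (a : R) (nu : S -> R) :
  (forall x y, a <= K x y) -> (forall x, \sum_y K x y = 1) -> \sum_x nu x = 0 ->
  \sum_y `|\sum_x nu x * K x y| <= (1 - #|S|%:R * a) * \sum_x `|nu x|.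
Proof.
move=> Ka K1 nu0.
have -> : (1 - #|S|%:R * a) * \sum_x `|nu x|
    = \sum_y \sum_x `|nu x| * (K x y - a).
  rewrite exchange_big mulr_sumr; apply: eq_bigr => x _ /=.
  rewrite -mulr_sumr mulrC; congr (_ * _).
  by rewrite sumrB K1 sumr_const mulr_natl.
apply: ler_sum => y _.
have -> : \sum_x nu x * K x y = \sum_x nu x * (K x y - a).
  under [RHS]eq_bigr do rewrite mulrBr.
  by rewrite sumrB -mulr_suml nu0 mul0r subr0.
apply: (le_trans (ler_norm_sum _ _ _)); apply: ler_sum => x _.
by rewrite normrM [`|K x y - a|]ger0_norm // subr_ge0.
Qed.

(** The chain can stay put at every state. *)
Hypothesis P_lazy : forall x, 0 < P x x.

Lemma lazy_aperiodic : aperiodic P.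
Proof.
move=> x; split=> [t _ _|d dx]; first exact: dvd1n.
by apply: dx => //; rewrite nstep1.
Qed.

Hypothesis P_irr : irreducible P.

(** As the chain can stay put, once y is reachable from x in s steps it is
reachable in any larger number of steps; T is the largest of the times needed
for the various pairs. *)
Lemma nstep_uniform_lower_bound :
  exists T, exists2 a : R, 0 < a & forall x y, a <= nstep P T x y.
Proof.
have nstep_mono s t x y : (s <= t)%N -> 0 < nstep P s x y -> 0 < nstep P t x y.
  move=> /subnK <-; elim: (t - s)%N => // n IHn sxy.
  by rewrite addSn; apply: (nstepS_gt0 _ _ _ x) (IHn sxy).
have [tau tauP] := fin_all_exists (fun p : S * S => P_irr p.1 p.2).
pose T := (\max_p tau p)%N; exists T.
have T_gt0 x y : 0 < nstep P T x y.
  by apply: (nstep_mono (tau (x, y))) (tauP (x, y)); apply: leq_bigmax.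
exists (\big[Num.min/1]_(p : S * S) nstep P T p.1 p.2).
  by apply/bigmin_gtP; split=> [|p _]; [exact: ltr01|exact: T_gt0].
by move=> x y; exact: (bigmin_le _ (x, y) (fun p => nstep P T p.1 p.2)).
Qed.

(** The l1 distance D between the law at time t and pi is nonincreasing, by the
contraction lemma with bound 0, and T steps multiply it by at most c < 1. *)
Lemma nstep_cvg_stationary pi mu y : stationary P pi -> is_distribution mu ->
  ((fun t => \sum_x mu x * nstep P t x y) @ \oo --> pi y)%classic.
Proof.
move=> pi_stat [_ mu1]; have [[_ pi1] _] := pi_stat.
have [T [a a_gt0 Ta]] := nstep_uniform_lower_bound.
pose nu x := mu x - pi x.
pose c : R := 1 - #|S|%:R * a.
pose D t := \sum_z `|\sum_x nu x * nstep P t x z|.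
have nu0 t : \sum_y \sum_x nu x * nstep P t x y = 0.
  rewrite exchange_big /=; under eq_bigr do rewrite -mulr_sumr nstep_sum1 mulr1.
  by rewrite sumrB mu1 pi1 subrr.
have D_step s t b : (forall x y, b <= nstep P t x y) ->
    D (s + t)%N <= (1 - #|S|%:R * b) * D s.
  move=> tb; apply: le_trans (l1_contraction _ _ _ tb (nstep_sum1 t) (nu0 s)).
  apply: ler_sum => z _; rewrite le_eqVlt; apply/orP; left; apply/eqP.
  congr `|_|.
  under eq_bigr do rewrite nstepD mulr_sumr.
  rewrite exchange_big; apply: eq_bigr => u _ /=; rewrite mulr_suml.
  by apply: eq_bigr => x _; rewrite mulrA.
have D_ge0 t : 0 <= D t by apply: sumr_ge0.
have c_lt1 : c < 1.
  (* S is not empty, as mu has total mass 1. *)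
  rewrite ltrBlDr ltrDl mulr_gt0 // ltr0n lt0n; apply/eqP => /card0_eq S0.
  by have := oner_neq0 R; rewrite -mu1 big_pred0 ?eqxx // => x; have := S0 x.
have c_ge0 : 0 <= c.
  rewrite subr_ge0 mulr_natl -sumr_const -(nstep_sum1 T y).
  exact: ler_sum.
have D_geom m : D (m * T)%N <= c ^+ m * D 0%N.
  elim: m => [|m IHm]; first by rewrite expr0 mul1r.
  rewrite mulSn addnC exprS -mulrA; apply: le_trans (D_step _ _ _ Ta) _.
  exact: ler_wpM2l.
have D_mono s t : (s <= t)%N -> D t <= D s.
  move=> /subnKC <-; have := D_step s (t - s)%N 0 (nstep_ge0 (t - s)%N).
  by rewrite mulr0 subr0 mul1r.
have cD0 : ((fun m => c ^+ m * D 0%N) @ \oo --> 0)%classic.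
  have c0 : ((fun m => c ^+ m) @ \oo --> (0 : R))%classic.
    by apply: cvg_expr; rewrite ger0_norm.
  have : ((fun m => c ^+ m * D 0%N) @ \oo --> 0 * D 0%N)%classic.
    exact: cvgMr_tmp c0.
  by rewrite mul0r.
apply/cvgrPdist_lt => eps eps_gt0.
move/cvgrPdist_lt/(_ _ eps_gt0): cD0 => [m _ /(_ m (leqnn m))].
rewrite /= sub0r normrN => cm_lt.
exists (m * T)%N => // t /= mT_t.
rewrite distrC -(stationary_nstep pi t y pi_stat) -sumrB.
have -> : \sum_x (mu x * nstep P t x y - pi x * nstep P t x y)
    = \sum_x nu x * nstep P t x y by apply: eq_bigr => x _; rewrite mulrBl.
apply: le_lt_trans cm_lt; apply: le_trans (ler_norm _).
apply: le_trans (D_geom m); apply: le_trans (D_mono _ _ mT_t).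
by rewrite /D [leRHS](bigD1 y) //= lerDl sumr_ge0.
Qed.

Lemma stationary_unique pi pi' :
  stationary P pi -> stationary P pi' -> pi =1 pi'.
Proof.
move=> pi_stat pi'_stat y; have [pi'_dist _] := pi'_stat.
have pi'_cvg := nstep_cvg_stationary pi pi' y pi_stat pi'_dist.
rewrite (_ : (fun t => _) = fun=> pi' y) in pi'_cvg; last first.
  by apply/boolp.funext => t; apply: stationary_nstep.
apply/esym/(cvg_unique (@norm_hausdorff _ _) _ pi'_cvg); exact: cvg_cst.
Qed.

Lemma stationary_ergodic pi :
  stationary P pi -> (forall x, 0 < pi x) -> ergodic P.
Proof.
move=> pi_stat pi_gt0; exists pi; split=> // mu mu_dist y.
exact: nstep_cvg_stationary.
Qed.

End FiniteChain.

(** * The exclusion chain *)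

Section ExclusionChain.
Variables (R : realType) (L : sgraph) (k : nat) (k_gt0 : (0 < k)%N).
Hypothesis k_le : (k <= #|L|)%N.
Implicit Types v w : token L k.

Let tdeg v : nat := @deg (token_graph L k) v.
Let mass : nat := (2 * #|edges (token_graph L k)| + k * 'C(#|L|, k))%N.

(** This expresses that the transition probabilities out of v, whose numerators
are given by [card_draws_to], add up to 1. *)
Lemma card_draws_token v : #|draws (token_set v)| = (tdeg v + k)%N.
Proof.
have draws_gt0 : (0 < #|draws (token_set v)|)%N.
  have /card_gt0P[x xv] : (0 < #|token_set v|)%N by rewrite card_token_set.
  by apply/card_gt0P; exists (inr x); rewrite inE.
have := exclusion_trans_sum1 R k_gt0 v; rewrite -mulr_suml -natr_sum.
under eq_bigr do rewrite card_draws_to.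
move/(canRL (mulfVK _)) => /(_ _)/eqP; rewrite mul1r eqr_nat => E.
rewrite -(eqP (E _)) ?pnatr_eq0 -?lt0n // big_split /=; congr addn.
  rewrite /tdeg /deg -sum1dep_card [RHS]big_mkcond; apply: eq_bigr => w _.
  by rewrite /=; case: token_adj.
rewrite (bigD1 v) //= eqxx muln1 big1 ?addn0 // => w.
by rewrite eq_sym => /negbTE->; rewrite muln0.
Qed.

Lemma exclusion_transE v w :
  exclusion_trans R v w = (token_adj v w + k * (v == w))%:R / (tdeg v + k)%:R.
Proof. by rewrite /exclusion_trans card_draws_to card_draws_token. Qed.

Lemma exclusion_trans_loop v : 0 < exclusion_trans R v v.
Proof.
rewrite exclusion_transE token_adj_irrefl eqxx muln1.
by rewrite divr_gt0 // ltr0n ?addn_gt0 k_gt0 ?orbT.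
Qed.

Lemma exclusion_trans_adj v w : token_adj v w -> 0 < exclusion_trans R v w.
Proof.
move=> vw; rewrite exclusion_transE vw.
by rewrite divr_gt0 // ltr0n addn_gt0 ?k_gt0 ?orbT.
Qed.

(** The distribution proportional to deg_k + k; its normalising constant is the
sum of these weights by [sum_exclusion_weight]. *)
Definition exclusion_dist v : R := (tdeg v + k)%:R / mass%:R.

Lemma sum_exclusion_weight : (\sum_v (tdeg v + k) = mass)%N.
Proof.
by rewrite big_split /= (sum_deg (token_graph L k)) sum_nat_const card_token
  [(_ * k)%N]mulnC.
Qed.

Lemma mass_gt0 : (0 < mass)%N.
Proof. by rewrite addn_gt0 !muln_gt0 k_gt0 bin_gt0 k_le orbT. Qed.

Lemma exclusion_dist_gt0 v : 0 < exclusion_dist v.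
Proof. by rewrite divr_gt0 // ltr0n ?mass_gt0 // addn_gt0 k_gt0 orbT. Qed.

Lemma exclusion_dist_is_distribution : is_distribution exclusion_dist.
Proof.
split=> [v|]; first exact/ltW/exclusion_dist_gt0.
rewrite -mulr_suml -natr_sum sum_exclusion_weight divff //.
by rewrite pnatr_eq0 -lt0n mass_gt0.
Qed.

Lemma exclusion_detailed_balance v w :
  exclusion_dist v * exclusion_trans R v w
  = exclusion_dist w * exclusion_trans R w v.
Proof.
have balE u u' : exclusion_dist u * exclusion_trans R u u'
    = (token_adj u u' + k * (u == u'))%:R / mass%:R.
  rewrite exclusion_transE mulrC mulrA divfK //.
  by rewrite pnatr_eq0 -lt0n addn_gt0 k_gt0 orbT.
by rewrite !balE token_adj_sym eq_sym.
Qed.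

Lemma exclusion_dist_stationary :
  stationary (exclusion_chain R L k_gt0) exclusion_dist.
Proof.
apply: detailed_balance_stationary exclusion_dist_is_distribution _.
exact: exclusion_detailed_balance.
Qed.

End ExclusionChain.

Theorem theorem3p1 (R : realType) (L : sgraph) (n d k : nat)
    (card_L : #|L| = n)
    (connected_L : connected_graph L)
    (regular_L : regular_graph L d)
    (connected_Lc : connected_graph (compl_graph L))
    (k_gt0 : (0 < k)%N) (k_lt : (k <= n - 1)%N) :
  let chain := exclusion_chain R L k_gt0 in
  [/\ aperiodic chain, irreducible chain, ergodic chain, reversible chain &
    forall pi : token L k -> R,
      stationary chain pi <->
      forall v : token L k,
        pi v = (@deg (token_graph L k) v + k)%:R
               / (2 * #|edges (token_graph L k)| + k * 'C(n, k))%:R].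
Proof.
move=> chain.
have k_le : (k <= #|L|)%N by rewrite card_L (leq_trans k_lt) ?leq_subr.
have lazy v : 0 < chain v v by apply: exclusion_trans_loop.
have irr : irreducible chain.
  apply: (connected_irreducible _ _ _ (@token_adj L k)) => [v w|].
    exact: exclusion_trans_adj.
  exact: connected_token_graph.
have stat : stationary chain (exclusion_dist R L k).
  exact: exclusion_dist_stationary.
split=> //.
- exact: lazy_aperiodic.
- apply: (stationary_ergodic _ _ _ lazy irr _ stat) => v.
  exact: exclusion_dist_gt0.
- exists (exclusion_dist R L k); split=> // v w.
  exact: exclusion_detailed_balance.
move=> pi; rewrite -card_L; split=> [pi_stat v|piE].
  exact: (stationary_unique _ _ _ lazy irr _ _ pi_stat stat).
have -> // : pi = exclusion_dist R L k by apply/boolp.funext.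
Qed.
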